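(* For an integer $k$, a non-trivial $[P_3]$-irregular graph of order $k$ exists if and only if $k \ge 7$.
   Context: All graphs are simple, finite and undirected. The order of a graph is its number of vertices; a graph is non-trivial if its order is at least $2$. $P_3$ denotes the path with $3$ vertices. For a graph $G$, the $[P_3]$-degree of a vertex $v$ of $G$ is the number of induced subgraphs of $G$ that are isomorphic to $P_3$ and contain $v$. A graph $G$ is $[P_3]$-irregular if the $[P_3]$-degrees of its vertices are pairwise distinct. *)

(* Defs.v *)
From mathcomp Require Import all_boot all_order all_algebra.

Set Implicit Arguments.
Unset Strict Implicit.
Unset Printing Implicit Defensive.

Record sgraph := SGraph {
  vertex :> finType;
  adj : rel vertex;
  adj_sym : symmetric adj;
  adj_irrefl : irreflexive adj }.

Definition graph_order (G : sgraph) : nat := #|G|.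

Definition non_trivial (G : sgraph) : bool := 2 <= graph_order G.

Section Induced.
Variables (G : sgraph) (S : {set G}).

Definition induced_adj : rel {x : G | x \in S} :=
  fun x y => adj (val x) (val y).

Lemma induced_adj_sym : symmetric induced_adj.
Proof. by move=> x y; apply: adj_sym. Qed.

Lemma induced_adj_irrefl : irreflexive induced_adj.
Proof. by move=> x; apply: adj_irrefl. Qed.

Definition induced : sgraph := SGraph induced_adj_sym induced_adj_irrefl.
End Induced.

Section Path.
Variable n : nat.

Definition path_adj : rel 'I_n :=
  fun i j => (i.+1 == j :> nat) || (j.+1 == i :> nat).

Lemma path_adj_sym : symmetric path_adj.
Proof. by move=> i j; rewrite /path_adj orbC. Qed.

Lemma path_adj_irrefl : irreflexive path_adj.
Proof. by move=> i; rewrite /path_adj orbb eqn_leq ltnn. Qed.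

Definition path_graph : sgraph := SGraph path_adj_sym path_adj_irrefl.
End Path.

(* Boolean so that it can be counted over; see [isomorphicP]. *)
Definition isomorphic (G H : sgraph) : bool :=
  [exists f : {ffun G -> H},
    [&& injectiveb f, [forall y, y \in codom f] &
        [forall x, forall y, adj (f x) (f y) == adj x y]]].

Lemma isomorphicP (G H : sgraph) :
  reflect (exists2 f : G -> H, bijective f & {mono f : x y / adj x y})
          (isomorphic G H).
Proof.
apply: (iffP existsP) => [[f /and3P[/injectiveP inj_f /forallP sur_f]]|[f bij_f mono_f]].
  move=> /forallP mono_f; exists f; last first.
    by move=> x y; have /forallP/(_ y)/eqP := mono_f x.
  exists (fun y => iinv (sur_f y)) => [x|y]; last exact: f_iinv.
  by apply: inj_f; rewrite f_iinv.
case: (bij_f) => g fK gK; exists (finfun f); apply/and3P; split.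
- by apply/injectiveP => x y; rewrite !ffunE; apply: bij_inj.
- by apply/forallP=> y; apply/codomP; exists (g y); rewrite ffunE gK.
- by apply/forallP=> x; apply/forallP=> y; rewrite !ffunE mono_f.
Qed.

(* An induced subgraph is determined by its vertex set, so the induced
   subgraphs are counted by their vertex sets. *)
Definition induced_degree (H G : sgraph) (v : G) : nat :=
  #|[set S : {set G} | (v \in S) && isomorphic (induced S) H]|.

Definition P3_degree (G : sgraph) (v : G) : nat :=
  induced_degree (path_graph 3) v.

Definition P3_irregular (G : sgraph) : Prop := injective (@P3_degree G).

(* Main.v *)
Require Import Defs.
From mathcomp Require Import all_boot all_order all_algebra.
From mathcomp Require Import zify.

Set Implicit Arguments.
Unset Strict Implicit.
Unset Printing Implicit Defensive.

(* The [P_3]-degree of [v] counts the pairs [x, y] spanning exactly two edges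
   with [v]; with this count, orders 2 to 6 are excluded by enumerating all
   graphs.  For the odd orders [2 m + 1 >= 9], join a new vertex to all
   vertices but the top one on one side of the half graph [a_i ~ b_j] iff
   [i + j >= m - 1], for [0 <= i, j < m]: the [P_3]-degrees are then
   [(i + 1) m - 1] at [a_i], [(j + 2) m - 2] at [b_j] for [j < m - 1],
   [(m - 1) m] at [b_(m - 1)] and [(m - 1)^2] at the new vertex.  They are
   distinct and positive, so that an isolated vertex can be added to get the
   even orders.  Orders 7 and 8 come in the same way from one explicit graph. *)

(** * Induced paths as triples spanning two edges *)

Definition edges3 T (e : rel T) v x y : nat := e v x + e v y + e x y.

(** The case [x = y] is not ruled out here: it satisfies the test whenever [x] is a neighbour of
    [v], so the sums below exclude it by an order or by [x != y]. *)
Definition is_P3 (T : eqType) (e : rel T) (v x y : T) : bool :=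
  [&& x != v, y != v & edges3 e v x y == 2].

Lemma path_graph3_iso (G : sgraph) (a b c : G) :
  adj a b -> adj b c -> ~~ adj a c -> a != c ->
  isomorphic (induced [set a; b; c]) (path_graph 3).
Proof.
move=> ab bc /negbTE ac neq_ac.
have neq_ab : a != b by apply: contraL ab => /eqP ->; rewrite adj_irrefl.
have neq_bc : b != c by apply: contraL bc => /eqP ->; rewrite adj_irrefl.
set S := [set a; b; c].
pose f (u : {x : G | x \in S}) : 'I_3 :=
  if val u == a then inord 0 else if val u == b then inord 1 else inord 2.
have SP (u : {x : G | x \in S}) : [\/ val u = a, val u = b | val u = c].
  have := valP u; rewrite !inE => /orP[/orP[]|] /eqP ->.
  - exact: Or31.
  - exact: Or32.
  - exact: Or33.
have fa u : val u = a -> f u = inord 0 by rewrite /f => ->; rewrite eqxx.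
have fb u : val u = b -> f u = inord 1.
  by rewrite /f => ->; rewrite eq_sym (negbTE neq_ab) eqxx.
have fc u : val u = c -> f u = inord 2.
  by rewrite /f => ->; rewrite !(eq_sym c) (negbTE neq_ac) (negbTE neq_bc).
apply/isomorphicP; exists f; last first.
  move=> u w; rewrite /= /path_adj /induced_adj.
  case: (SP u) => Eu; case: (SP w) => Ew; rewrite Eu Ew;
    rewrite ?(fa _ Eu) ?(fb _ Eu) ?(fc _ Eu) ?(fa _ Ew) ?(fb _ Ew) ?(fc _ Ew);
    by rewrite !inordK // ?adj_irrefl // ?ab ?bc ?ac // adj_sym ?ab ?bc ?ac.
apply: inj_card_bij => [u w|].
  case: (SP u) => Eu; case: (SP w) => Ew;
    rewrite ?(fa _ Eu) ?(fb _ Eu) ?(fc _ Eu) ?(fa _ Ew) ?(fb _ Ew) ?(fc _ Ew);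
    move=> /(congr1 val); rewrite /= !inordK // => _;
    by apply: val_inj; rewrite Eu Ew.
rewrite card_ord card_sig -(@eq_card _ S) // /S.
by rewrite -setUA cardsU1 !inE cards2 negb_or neq_ab neq_ac neq_bc.
Qed.

Lemma induced_P3E (G : sgraph) (v x y : G) :
  x != v -> y != v -> x != y ->
  isomorphic (induced [set v; x; y]) (path_graph 3) = (edges3 (@adj G) v x y == 2).
Proof.
move=> xv yv xy; apply/idP/idP.
  case/isomorphicP=> f [g fK gK] fM.
  have gM i j : adj (g i) (g j) = path_adj i j by rewrite -fM !gK.
  pose h i := val (g i).
  have hM i j : adj (h i) (h j) = path_adj i j by rewrite -gM.
  have h_inj : injective h by apply: inj_comp val_inj (can_inj gK).
  pose o0 : 'I_3 := ord0; pose o2 : 'I_3 := ord_max; pose o1 : 'I_3 := inord 1.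
  have v1 : o1 = 1 :> nat by rewrite inordK.
  have := (hM o0 o1, hM o1 o2, hM o0 o2).
  have : [/\ h o0 != h o1, h o1 != h o2 & h o0 != h o2].
    by rewrite !(inj_eq h_inj) -!val_eqE /= v1.
  have := (valP (g o0), valP (g o1), valP (g o2)).
  rewrite /path_adj v1 /= -!/(h _) !inE /edges3.
  move: (h o0) (h o1) (h o2) => a b c [[ha hb] hc] [nab nbc nac] [[ab bc] ac].
  move: nab nbc nac ab bc ac.
  have [sx sy] := (adj_sym x v, adj_sym y v); have syx := adj_sym y x.
  (* Of the 27 placements of [a], [b], [c] among [v], [x], [y], only the six permutations survive
     the distinctness conditions. *)
  by case/orP: ha => [/orP[]|] /eqP ->;
     case/orP: hb => [/orP[]|] /eqP ->;
     case/orP: hc => [/orP[]|] /eqP -> //; rewrite ?eqxx //;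
     move=> _ _ _; rewrite ?sx ?sy ?syx => -> -> ->.
(* Conversely, the vertex common to the two edges becomes the middle of the path. *)
rewrite /edges3.
case vx: (adj v x); case vy: (adj v y); case Exy: (adj x y) => //= _.
- have -> : [set v; x; y] = [set x; v; y].
    by congr (_ :|: _); rewrite setUC.
  by apply: path_graph3_iso; rewrite ?Exy // adj_sym.
- by apply: path_graph3_iso; rewrite ?vx ?vy // eq_sym.
- have -> : [set v; x; y] = [set v; y; x] by rewrite -!setUA [[set x; y]]setUC.
  by apply: path_graph3_iso; rewrite ?vx // ?[v == _]eq_sym // adj_sym.
Qed.

Lemma isomorphic_P3_card (G : sgraph) (S : {set G}) :
  isomorphic (induced S) (path_graph 3) -> #|S| = 3.
Proof.
case/isomorphicP=> f /bij_eq_card + _; rewrite card_ord card_sig => <-.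
exact: eq_card.
Qed.

(** The ranking [r] selects one of the two orders of each pair, which makes [tri] injective on [D].
    It is kept arbitrary so that any numbering of the vertices can be used. *)
Lemma P3_degree_ordered (G : sgraph) (r : G -> nat) (v : G) : injective r ->
  P3_degree v = \sum_(x : G) \sum_(y | r y < r x) is_P3 (@adj G) v x y.
Proof.
move=> r_inj.
pose D := [set p : G * G | (r p.2 < r p.1) && is_P3 (@adj G) v p.1 p.2].
pose tri (p : G * G) := [set v; p.1; p.2].
have -> : P3_degree v = #|tri @: D|.
  apply: eq_card => S; rewrite inE; apply/andP/imsetP.
    case=> vS isoS; have := isomorphic_P3_card isoS.
    rewrite (cardsD1 v) vS add1n => /eqP; rewrite eqSS => /cards2P[x [y [xy ES]]].
    have ESv : S = [set v; x; y] by rewrite -setUA -ES setD1K.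
    have : x \in S :\ v by rewrite ES !inE eqxx.
    have : y \in S :\ v by rewrite ES !inE eqxx orbT.
    rewrite !inE => /andP[yv _] /andP[xv _].
    move: isoS; rewrite ESv induced_P3E // => E2.
    have [lt_yx | lt_xy | /r_inj Exy] := ltngtP (r y) (r x).
    + by exists (x, y) => //; rewrite !inE /is_P3 /= lt_yx xv yv E2.
    + exists (y, x); last by rewrite /tri /= -!setUA [[set y; x]]setUC.
      rewrite !inE /is_P3 /= lt_xy xv yv /=; move: E2.
      by rewrite /edges3 (adj_sym y x) [adj v y + _]addnC.
    + by rewrite Exy eqxx in xy.
  case=> -[x y]; rewrite inE /= => /andP[lt_yx /and3P[xv yv E2]] ->.
  rewrite /tri /= !inE eqxx; split=> //; rewrite induced_P3E //.
  by apply: contraTneq lt_yx => ->; rewrite ltnn.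
rewrite card_in_imset; last first.
  move=> [x y] [x' y']; rewrite !inE /= => /andP[lt /and3P[xv yv _]].
  move=> /andP[lt' /and3P[xv' yv' _]] /setP E.
  have := (E x, E y, E x', E y'); rewrite /tri !inE /= !eqxx !orbT.
  rewrite (negbTE xv) (negbTE yv) (negbTE xv') (negbTE yv') /=.
  case=> [[[/esym/orP[]/eqP Ex /esym/orP[]/eqP Ey] _] _];
    move: lt lt'; rewrite ?Ex ?Ey ?ltnn //.
  by move=> lt /(ltn_trans lt); rewrite ltnn.
rewrite pair_big_dep /= -sum1_card [LHS]big_mkcond [RHS]big_mkcond /=.
by apply: eq_bigr => p _; rewrite inE; case: (_ < _); case: is_P3.
Qed.

(** Two copies of the ordered sum, one with its variables exchanged, cover all pairs with [x != y];
    the result is free of any ranking. *)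
Lemma P3_degree_double (G : sgraph) (v : G) :
  (P3_degree v).*2 = \sum_x \sum_y ((x != y) && is_P3 (@adj G) v x y).
Proof.
pose r (x : G) : nat := enum_rank x.
have r_inj : injective r by move=> x y /val_inj/enum_rank_inj.
rewrite -addnn {2}(P3_degree_ordered v r_inj) (P3_degree_ordered v r_inj).
rewrite [X in _ + X](exchange_big_dep predT) //= -big_split /=.
apply: eq_bigr => x _; rewrite [X in X + _]big_mkcond [X in _ + X]big_mkcond.
rewrite -big_split /=; apply: eq_bigr => y _.
have -> : is_P3 (@adj G) v y x = is_P3 (@adj G) v x y.
  rewrite /is_P3 /edges3 (adj_sym y x) [adj v y + _]addnC.
  by case: (x == v); case: (y == v).
rewrite -(inj_eq r_inj) neq_ltn; case: ltngtP => // _; case: is_P3 => //.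
Qed.

(** * A degree formula for triangle-free graphs *)

Definition degree (G : sgraph) (v : G) : nat := \sum_x (adj v x : nat).

(* The summands count the pairs [x, y] with two prescribed edges in [v, x, y];
   the degenerate pairs contribute [3 * degree v]. *)
Lemma P3_degree_triangle_free (G : sgraph) (v : G) :
  (forall x y, adj v x -> adj v y -> ~~ adj x y) ->
  (P3_degree v).*2 + 3 * degree v =
    degree v ^ 2 + (\sum_x adj v x * degree x).*2.
Proof.
move=> triF.
pose E x y := ((x != y) && is_P3 (@adj G) v x y : nat) + ((x == y) * adj v x
  + (y == v) * adj v x + (x == v) * adj v y).
pose F x y := adj v x * adj v y + (adj v x * adj x y + adj v y * adj y x).
(* For distinct [v], [x], [y], exactly one product in [F] is 1 if the triple spans two edges, and
   none if it spans fewer; [triF] excludes three edges. *)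
have EF x y : E x y = F x y.
  rewrite /E /F /is_P3 /edges3 (adj_sym y x).
  have [->|xv] := eqVneq x v.
    by rewrite adj_irrefl andbF (eq_sym v y); case: eqP; case: adj.
  have [->|yv] := eqVneq y v.
    by rewrite adj_irrefl (negbTE xv) (adj_sym x v) /=; case: adj.
  have [->|xy] := eqVneq x y; first by rewrite adj_irrefl; case: adj.
  rewrite /=; have := triF x y.
  by case: (adj v x); case: (adj v y); case: (adj x y) => // /(_ isT isT).
transitivity (\sum_x \sum_y E x y).
  rewrite P3_degree_double; under [RHS]eq_bigr do rewrite !big_split /=.
  rewrite !big_split /=; congr (_ + _); rewrite !mulSn mul0n addn0 addnA.
  congr (_ + _ + _).
  - apply: eq_bigr => x _; rewrite (bigD1 x) //= eqxx mul1n big1 ?addn0 // => y.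
    by rewrite eq_sym => /negbTE ->.
  - apply: eq_bigr => x _; rewrite (bigD1 v) //= eqxx mul1n big1 ?addn0 // => y.
    by move=> /negbTE ->.
  - rewrite (bigD1 v) //= [X in _ = _ + X]big1 => [|x /negbTE -> ]; last first.
      by rewrite big1.
    by rewrite addn0; apply: eq_bigr => y _; rewrite eqxx mul1n.
under eq_bigr do under eq_bigr do rewrite EF.
under eq_bigr do rewrite !big_split /=.
rewrite !big_split /=; congr (_ + _).
  by rewrite expnS expn1 /degree big_distrlr.
rewrite -addnn [X in _ + X]exchange_big /=.
by congr (_ + _); apply: eq_bigr => x _; rewrite /degree big_distrr.
Qed.

(** * Adding an isolated vertex *)

Section Isolated.
Variable G : sgraph.

Definition isolated_adj : rel (G + unit) :=
  fun u w => if (u, w) is (inl x, inl y) then adj x y else false.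

Lemma isolated_adj_sym : symmetric isolated_adj.
Proof. by move=> [x|[]] [y|[]] //=; apply: adj_sym. Qed.

Lemma isolated_adj_irrefl : irreflexive isolated_adj.
Proof. by move=> [x|[]] //=; apply: adj_irrefl. Qed.

Definition add_isolated : sgraph :=
  SGraph isolated_adj_sym isolated_adj_irrefl.

Lemma add_isolated_order : graph_order add_isolated = (graph_order G).+1.
Proof. by rewrite /graph_order card_sum card_unit addn1. Qed.

(** A triple containing the isolated vertex spans at most one edge. *)
Lemma P3_degree_isolated : P3_degree (inr tt : add_isolated) = 0.
Proof.
apply: double_inj; rewrite P3_degree_double big1 // => x _; rewrite big1 // => y _.
by rewrite /is_P3 /edges3 /= add0n; case: isolated_adj; rewrite !andbF.
Qed.

Lemma P3_degree_add_isolated (v : G) :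
  P3_degree (inl v : add_isolated) = P3_degree v.
Proof.
apply: double_inj; rewrite !P3_degree_double big_sumType /=.
rewrite [X in _ + X]big1 => [|[] _]; last first.
  rewrite big1 // => -[y|[]] _ //=; rewrite /is_P3 /edges3 /=.
    by case: isolated_adj; rewrite andbF.
rewrite addn0; apply: eq_bigr => x _; rewrite big_sumType /=.
rewrite [X in _ + X]big1 ?addn0 // => -[] _; rewrite /is_P3 /edges3 /=.
by case: isolated_adj; rewrite andbF.
Qed.

Lemma add_isolated_irregular :
  P3_irregular G -> (forall v : G, 0 < P3_degree v) -> P3_irregular add_isolated.
Proof.
move=> irrG posG [x|[]] [y|[]] //; rewrite ?P3_degree_isolated ?P3_degree_add_isolated.
- by move/irrG->.
- by move=> E; have := posG x; rewrite E.
- by move=> E; have := posG y; rewrite -E.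
Qed.
End Isolated.

(** * Evaluation of degrees and enumeration of the small graphs *)

Definition count_P3 (e : rel nat) (n v : nat) : nat :=
  sumn [seq count (is_P3 e v x) (iota 0 x) | x <- iota 0 n].

Lemma P3_degree_count (G : sgraph) (n : nat) (e : rel nat) (r : G -> 'I_n) (v : G) :
  bijective r -> {mono (fun x => val (r x)) : x y / adj x y >-> e x y} ->
  P3_degree v = count_P3 e n (r v).
Proof.
move=> bij_r rM; have r_inj := bij_inj bij_r.
rewrite (P3_degree_ordered (r := fun x => r x)); last exact: inj_comp val_inj r_inj.
rewrite /count_P3 sumnE big_map -[n in iota 0 n]subn0 big_mkord.
have [s rK sK] := bij_r.
rewrite (reindex s) /=; last by exists r => x _; rewrite ?rK ?sK.
apply: eq_bigr => i _; rewrite (reindex s) /=; last by exists r => x _; rewrite ?rK ?sK.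
rewrite -sum1_count -[i in iota 0 i]subn0 big_mkord.
rewrite (big_ord_widen_cond n (is_P3 e (r v) i) (fun=> 1)) 1?ltnW //.
rewrite big_mkcond [RHS]big_mkcond; apply: eq_bigr => j _; rewrite !sK.
rewrite /is_P3 /edges3 -!rM !sK -!(inj_eq r_inj) !sK -!val_eqE.
by case: (j < i); rewrite ?andbT ?andbF.
Qed.

Fixpoint all_bits n (P : pred (seq bool)) : bool :=
  if n is n'.+1 then
    all_bits n' (fun s => P (true :: s)) && all_bits n' (fun s => P (false :: s))
  else P [::].

Lemma all_bitsP n P s : all_bits n P -> size s = n -> P s.
Proof.
elim: n P s => [|n IH] P [|b s] //= /andP[Pt Pf] [sz].
by case: b; [apply: (IH _ s Pt) | apply: (IH _ s Pf)].
Qed.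

(** A graph is encoded by its adjacency matrix strictly below the diagonal. The predicate is passed
    down as a continuation, so the list of all matrices is never built. *)
Fixpoint all_lower n (P : pred (seq (seq bool))) : bool :=
  if n is n'.+1 then
    all_bits n' (fun row => all_lower n' (fun M => P (rcons M row)))
  else P [::].

Definition lower (e : rel nat) n : seq (seq bool) :=
  mkseq (fun i => mkseq (e i) i) n.

Lemma all_lowerP n P e : all_lower n P -> P (lower e n).
Proof.
elim: n P => [|n IH] P //= H; rewrite /lower mkseqS.
have /IH := all_bitsP H (size_mkseq (e n) n); exact.
Qed.

(** At most one of the two positions lies in the triangle; the other reads the default [false]. *)
Definition entry (M : seq (seq bool)) : rel nat := fun i j =>
  nth false (nth [::] M i) j || nth false (nth [::] M j) i.

Lemma entry_lower (e : rel nat) n i j : symmetric e -> irreflexive e ->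
  i < n -> j < n -> entry (lower e n) i j = e i j.
Proof.
move=> e_sym e_irr ltin ltjn; rewrite /entry !(nth_mkseq _ (fun k => mkseq (e k) k)) //.
have [ltij|ltji|->] := ltngtP i j.
- by rewrite nth_default ?size_mkseq 1?ltnW //= nth_mkseq // e_sym.
- by rewrite nth_mkseq // orbC nth_default ?size_mkseq 1?ltnW.
- by rewrite !nth_default ?size_mkseq ?e_irr.
Qed.

Definition no_irregular n : bool :=
  all_lower n (fun M => ~~ uniq [seq count_P3 (entry M) n v | v <- iota 0 n]).

Lemma no_irregularP (G : sgraph) :
  P3_irregular G -> no_irregular (graph_order G) = false.
Proof.
rewrite /graph_order; set n := #|G| => irrG; apply/negP => noG.
(* At order 0 the check itself is [false], the empty list being duplicate-free; otherwise a vertex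
   [x0] is available as default for [nth]. *)
case: (posnP n) => [n0|]; first by move: noG; rewrite n0.
case/card_gt0P=> x0 _.
pose e i j := adj (nth x0 (enum G) i) (nth x0 (enum G) j).
have eE (x y : G) : e (enum_rank x) (enum_rank y) = adj x y.
  by rewrite /e !nth_enum_rank.
have /negP[] := all_lowerP e noG.
rewrite map_inj_in_uniq ?iota_uniq // => i j; rewrite !mem_iota !add0n /= => lt_i lt_j.
have degE (k : 'I_n) : P3_degree (enum_val k) = count_P3 (entry (lower e n)) n k.
  rewrite (@P3_degree_count _ n (entry (lower e n)) enum_rank) ?enum_valK //.
    exact: enum_rank_bij.
  move=> x y /=; rewrite entry_lower ?eE // => [a b|a]; first exact: adj_sym.
  exact: adj_irrefl.
rewrite -[i]/(val (Ordinal lt_i)) -[j]/(val (Ordinal lt_j)) -!degE.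
by move=> /irrG/enum_val_inj->.
Qed.

Lemma irregular_order_ge7 (G : sgraph) :
  non_trivial G -> P3_irregular G -> 7 <= graph_order G.
Proof.
move=> ge2 irrG; rewrite leqNgt; apply/negP => lt7.
(* Orders 2 to 6; the last one takes [2 ^ 15] matrices. *)
have /allP small : all no_irregular (iota 2 5) by vm_compute.
have := no_irregularP irrG; rewrite small // mem_iota lt7 andbT.
exact: ge2.
Qed.

(** * An irregular graph of order 7 *)

Definition seven_edges : seq (nat * nat) :=
  [:: (0, 1); (0, 2); (0, 3); (0, 5); (1, 3); (1, 4); (1, 6); (2, 4); (3, 5); (4, 5)].

Definition seven_rel : rel nat :=
  fun i j => ((i, j) \in seven_edges) || ((j, i) \in seven_edges).

Definition seven_adj : rel 'I_7 := fun i j => seven_rel i j.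

Lemma seven_adj_sym : symmetric seven_adj.
Proof. by move=> i j; rewrite /seven_adj /seven_rel orbC. Qed.

Lemma seven_adj_irrefl : irreflexive seven_adj.
Proof. by case; do 7?case. Qed.

(** The extended half graph fails at this order: for [m = 3], both [b_0] and the extra vertex have
    [[P_3]]-degree 4. *)
Definition seven_graph : sgraph := SGraph seven_adj_sym seven_adj_irrefl.

Lemma seven_P3_degree (v : seven_graph) :
  P3_degree v = nth 0 [:: 8; 10; 6; 5; 9; 7; 3] (val v).
Proof.
rewrite (@P3_degree_count seven_graph 7 seven_rel id) //; last by exists id.
by case: v; do 7?case.
Qed.

Lemma seven_P3_degree_gt0 (v : seven_graph) : 0 < P3_degree v.
Proof. by rewrite seven_P3_degree; case: v; do 7?case. Qed.

Lemma seven_irregular : P3_irregular seven_graph.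
Proof.
move=> u w; rewrite !seven_P3_degree => /eqP.
by rewrite nth_uniq ?ltn_ord // => /eqP/val_inj.
Qed.

(** * The extended half graphs, of odd order *)

Section ExtendedHalfGraph.
Variable m : nat.

(* The vertices are the [a_i], the [b_j] and the extra vertex. *)
Definition ext_half_adj : rel ('I_m + 'I_m + unit) := fun u w =>
  match u, w with
  | inl (inl i), inl (inr j) | inl (inr j), inl (inl i) => m <= i + j + 1
  | inl (inr j), inr _ | inr _, inl (inr j) => j.+1 < m
  | _, _ => false
  end.

Lemma ext_half_adj_sym : symmetric ext_half_adj.
Proof. by move=> [[i|j]|[]] [[i'|j']|[]]. Qed.

Lemma ext_half_adj_irrefl : irreflexive ext_half_adj.
Proof. by move=> [[i|j]|[]]. Qed.

Definition ext_half_graph : sgraph := SGraph ext_half_adj_sym ext_half_adj_irrefl.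

Lemma ext_half_graph_order : graph_order ext_half_graph = m.*2.+1.
Proof. by rewrite /graph_order !card_sum card_unit !card_ord addn1 addnn. Qed.

Lemma ext_half_graph_triangle_free (v x y : ext_half_graph) :
  adj v x -> adj v y -> ~~ adj x y.
Proof. by case: v x y => [[i|j]|[]] [[i'|j']|[]] [[i''|j'']|[]]. Qed.

(** Across the half graph, the neighbours of index [i] are the top [i + 1] indices, listed downwards
    from [m - 1]. *)
Lemma sum_half (F : nat -> nat) (i : 'I_m) :
  \sum_(j < m) (m <= i + j + 1) * F j = \sum_(t < i.+1) F (m - t.+1).
Proof.
rewrite (big_ord_widen m (fun t => F (m - t.+1))) // [RHS]big_mkcond.
rewrite (reindex_inj rev_ord_inj) /=; apply: eq_bigr => j _.
have := ltn_ord i; have := ltn_ord j; case: (ltnP j i.+1) => ? ? ?.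
  by rewrite (_ : m <= _) ?mul1n //; lia.
by rewrite (_ : m <= _ = false) //; lia.
Qed.

Lemma sum_ltn_pred : \sum_(j < m) (j.+1 < m) = m.-1.
Proof.
case: m => [|n]; first by rewrite big_ord0.
rewrite big_ord_recr /= ltnn addn0 -[RHS]card_ord -sum1_card.
by apply: eq_bigr => j _; rewrite ltnS ltn_ord.
Qed.

Lemma sum_ltn_predM (F : nat -> nat) :
  \sum_(j < m) (j.+1 < m) * F j = \sum_(j < m.-1) F j.
Proof.
case: m => [|n]; first by rewrite !big_ord0.
rewrite big_ord_recr /= ltnn addn0.
by apply: eq_bigr => j _; rewrite ltnS ltn_ord mul1n.
Qed.

Lemma half_degree_a (i : 'I_m) : degree (inl (inl i) : ext_half_graph) = i.+1.
Proof.
rewrite /degree !big_sumType /= !big1_eq addn0 add0n.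
under eq_bigr do rewrite -[nat_of_bool _]muln1.
by rewrite (sum_half (fun=> 1)) sum1_card card_ord.
Qed.

Lemma half_degree_b (j : 'I_m) :
  degree (inl (inr j) : ext_half_graph) = j.+1 + (j.+1 < m).
Proof.
rewrite /degree !big_sumType /= big1_eq addn0; congr (_ + _); last first.
  by rewrite (big_pred1 tt) // => -[].
under eq_bigr do rewrite -[nat_of_bool _]muln1 [_ + j]addnC.
by rewrite (sum_half (fun=> 1)) sum1_card card_ord.
Qed.

Lemma half_degree_z : degree (inr tt : ext_half_graph) = m.-1.
Proof.
by rewrite /degree !big_sumType /= !big1_eq addn0 add0n sum_ltn_pred.
Qed.

Lemma sum_downward k : k <= m ->
  (\sum_(t < k) (m - t)).*2 + k * k = k * m.*2.+1.
Proof.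
elim: k => [|k IH] km; first by rewrite big_ord0.
have := IH (ltnW km); rewrite big_ord_recr /=.
set S := \sum_(t < k) _; move: S => S.
(* Writing [m] as [k + d] removes the truncated subtraction. *)
by have [d ->] : exists d, m = k + d; [exists (m - k); lia | nia].
Qed.

Lemma half_P3_degree_a (i : 'I_m) :
  P3_degree (inl (inl i) : ext_half_graph) = i * m + m.-1.
Proof.
have := P3_degree_triangle_free (@ext_half_graph_triangle_free (inl (inl i))).
rewrite half_degree_a !big_sumType /=.
rewrite [X in (X + _ + _).*2]big1 // [X in (_ + X).*2]big1 // addn0 add0n.
under eq_bigr do rewrite half_degree_b.
rewrite (sum_half (fun j => j.+1 + (j.+1 < m))) big_split /=.
have lt_im := ltn_ord i; rewrite (eq_bigr (fun t : 'I_i.+1 => m - t)); last first.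
  by move=> t _; have := ltn_ord t; lia.
(* The term [t = 0] is the top vertex, not joined to the extra one; the other [i] terms are 1. *)
rewrite [X in (_ + X).*2](_ : _ = i :> nat); last first.
  rewrite big_ord_recl /= -[RHS]card_ord -sum1_card.
  rewrite (_ : (m - 1).+1 < m = false) ?add0n; last by lia.
  apply: eq_bigr => t _; rewrite /= /bump /=; have := ltn_ord t.
  by move=> ?; rewrite (_ : _ < m = true) //; lia.
have := sum_downward lt_im; set S := \sum_(t < _) _.
by move: S => S; nia.
Qed.

Lemma half_P3_degree_b (j : 'I_m) :
  P3_degree (inl (inr j) : ext_half_graph) =
    if j.+1 < m then j.+1 * m + (m - 2) else m.-1 * m.
Proof.
have := P3_degree_triangle_free (@ext_half_graph_triangle_free (inl (inr j))).
rewrite half_degree_b !big_sumType /= [X in (_ + X + _).*2]big1 // addn0.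
rewrite (big_pred1 tt) => [|[]] //; rewrite half_degree_z.
(* The condition on the indices is symmetric, so [sum_half] applies with the two sides exchanged. *)
under eq_bigr do rewrite half_degree_a [_ + j]addnC.
rewrite (sum_half succn).
have lt_jm := ltn_ord j; rewrite (eq_bigr (fun t : 'I_j.+1 => m - t)); last first.
  by move=> t _; have := ltn_ord t; lia.
have := sum_downward lt_jm; set S := \sum_(t < _) _.
move: S => S; case: ltnP => [|le_mj]; first by nia.
move: (P3_degree _) (nat_of_ord j) lt_jm le_mj => p k lt_km le_mk.
by have -> : m = k.+1; [lia | nia].
Qed.

Lemma half_P3_degree_z : P3_degree (inr tt : ext_half_graph) = m.-1 * m.-1.
Proof.
have := P3_degree_triangle_free (@ext_half_graph_triangle_free (inr tt)).
rewrite half_degree_z !big_sumType /=.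
rewrite [X in (X + _ + _).*2]big1 // [X in (_ + X).*2]big1 // addn0 add0n.
under eq_bigr do rewrite half_degree_b.
rewrite (sum_ltn_predM (fun j => j.+1 + (j.+1 < m))) big_split /=.
(* Every neighbour of the extra vertex lies below the top, so each contributes 1. *)
rewrite [X in (_ + X).*2](_ : _ = m.-1); last first.
  rewrite -[RHS]card_ord -sum1_card; apply: eq_bigr => j _.
  by have := ltn_ord j; case: ltnP => //; lia.
have : forall k, (\sum_(j < k) j.+1).*2 = k * k.+1.
  by elim=> [|k IH]; rewrite ?big_ord0 // big_ord_recr /= doubleD IH; lia.
move/(_ m.-1); set S := \sum_(t < _) _.
by move: S => S; nia.
Qed.

Lemma half_P3_degree_gt0 (v : ext_half_graph) : 3 < m -> 0 < P3_degree v.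
Proof.
move=> m3; case: v => [[i|j]|[]].
- by rewrite half_P3_degree_a; lia.
- by rewrite half_P3_degree_b; case: ifP; nia.
- by rewrite half_P3_degree_z; nia.
Qed.

(* Modulo [m] the degrees are [-1] on one side, [-2] on the other side except
   for its top vertex, where it is [0], and [1] at the extra vertex. *)
Lemma ext_half_graph_irregular : 3 < m -> P3_irregular ext_half_graph.
Proof.
move=> m3.
(* Quotient and remainder of the degree by [m]. The remainders [m - 1], [m - 2], 0 and 1 are
   distinct as [m > 3], and Euclidean division is unique. *)
pose code (v : ext_half_graph) := match v with
  | inl (inl i) => (i : nat, m.-1)
  | inl (inr j) => if j.+1 < m then (j.+1, m - 2) else (m.-1, 0)
  | inr _ => (m - 2, 1) end.
have codeP v : P3_degree v = (code v).1 * m + (code v).2.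
  case: v => [[i|j]|[]] /=.
  - exact: half_P3_degree_a.
  - by rewrite half_P3_degree_b; case: ifP => //=; rewrite addn0.
  - by rewrite half_P3_degree_z; nia.
have code_lt v : (code v).2 < m.
  by case: v => [[i|j]|[]] /=; try case: ifP => /=; lia.
move=> u w; rewrite !codeP => /(congr1 (edivn^~ m)).
rewrite !edivn_eq //  -!surjective_pairing.
case: u => [[i|j]|[]]; case: w => [[i'|j']|[]] //=;
  do ?case: ifPn => ?; move=> /eqP; rewrite xpair_eqE => /andP[/eqP E1 /eqP E2];
  try lia; try by congr (inl (inl _)); apply: val_inj.
(* Two [b] vertices remain: below the top the quotient gives the index, and at the top the index is
   [m - 1]. *)
all: congr (inl (inr _)); apply: val_inj => /=.
all: by move: (ltn_ord j) (ltn_ord j'); lia.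
Qed.
End ExtendedHalfGraph.

(** * Existence for all orders from 7 on *)

Lemma irregular_exists (n : nat) : 7 <= n ->
  exists G : sgraph, [/\ non_trivial G, P3_irregular G & graph_order G = n].
Proof.
move=> ge7.
suff [G [irrG oG]] : exists G : sgraph, P3_irregular G /\ graph_order G = n.
  by exists G; split; rewrite // /non_trivial oG; lia.
(* Positivity is carried along because the isolated vertex takes the value 0. *)
have odd_case k : 7 <= k -> odd k -> exists G : sgraph,
    [/\ P3_irregular G, forall v : G, 0 < P3_degree v & graph_order G = k].
  move=> ge7k odd_k; have [->|k7] := eqVneq k 7.
    exists seven_graph; split; first exact: seven_irregular.
      exact: seven_P3_degree_gt0.
    exact: card_ord.
  (* Being odd and different from 7, [k] is at least 9. *)
  have m3 : 3 < k./2 by lia.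
  exists (ext_half_graph k./2); split; first exact: ext_half_graph_irregular.
    by move=> v; apply: half_P3_degree_gt0.
  by rewrite ext_half_graph_order; lia.
case: (boolP (odd n)) => [odd_n|even_n].
  by have [G [? _ ?]] := odd_case n ge7 odd_n; exists G.
have [||G [irrG posG oG]] := odd_case n.-1; [lia | lia |].
exists (add_isolated G); split; first exact: add_isolated_irregular.
by rewrite add_isolated_order oG; lia.
Qed.

Theorem theorem2 (k : int) :
  (exists G : sgraph, [/\ non_trivial G, P3_irregular G & Posz (graph_order G) = k])
  <-> (7 <= k)%R.
Proof.
split=> [[G [ntG irrG <-]]|]; first exact: irregular_order_ge7.
case: k => // n ge7; have [G [ntG irrG oG]] := irregular_exists ge7.
by exists G; split=> //; rewrite oG.
Qed.
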